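(* Let $H$ be a Hopf algebra with invertible antipode $S$ over a field $k$ of characteristic $0$. The functors $((-)'_H,\widehat{(-)}_H)$ form an adjoint pair (with $(-)'_H$ left adjoint to $\widehat{(-)}_H$) between the category $saYD\text{-mod}$ of stable anti-Yetter-Drinfeld modules over $H$ and the category $saYD\text{-ctrmd}$ of stable anti-Yetter-Drinfeld contramodules over $H$.
   Context: Sweedler notation: $\Delta(h)=h^1\otimes h^2$; a right coaction is $m\mapsto m_0\otimes m_1$. $\mathrm{Hom}$ denotes $k$-linear maps, $\mathrm{Hom}(-,-)^H$ right $H$-comodule maps; $f(a-b)$ means $x\mapsto f(axb)$. A right $H$-contramodule is a vector space $N$ with linear $\alpha:\mathrm{Hom}(H,N)\to N$ such that $\alpha(x\mapsto\alpha(h\mapsto f(x\otimes h)))=\alpha(h\mapsto f(h^1\otimes h^2))$ for $f\in\mathrm{Hom}(H\otimes H,N)$ and $\alpha(h\mapsto\epsilon(h)n)=n$. Anti-Yetter-Drinfeld ($aYD$) module: left $H$-module and right $H$-comodule $M$ with $(hm)_0\otimes(hm)_1=h^2m_0\otimes h^3m_1S(h^1)$; stable if $m_1m_0=m$ for all $m$. $aYD$-contramodule: left $H$-module and right $H$-contramodule $N$ with $h\alpha(f)=\alpha(h^2f(S(h^3)-h^1))$; stable if $\alpha(r_n)=n$ for all $n\in N$, where $r_n(h)=hn$. Morphisms preserve both structures; $saYD\text{-mod}$ and $saYD\text{-ctrmd}$ are the full subcategories of stable objects. Functors: for an $aYD$-module $M$, $\widehat{M}_H=\mathrm{Hom}(H,M)^H$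 with contraaction $(\alpha\theta)(h)=\theta_{h^1}(h^2)$ and $H$-action $(h\cdot\phi)(-)=h^2\phi(S(h^3)-h^1)$. For an $aYD$-contramodule $N$, $N'_H=H\odot_HN$ is the cokernel of the difference of the maps $H\otimes\mathrm{Hom}(H,N)\to H\otimes N$, $h\otimes f\mapsto h\otimes\alpha(f)$ and $h\otimes f\mapsto h^2\otimes f(h^1)$, with coaction $h\otimes n\mapsto(h^1\otimes n)\otimes h^2$ and $H$-action $x\cdot(h\otimes n)=x^3hS(x^1)\otimes x^2n$. *)

(* Defs.v *)
From HB Require Import structures.
From mathcomp Require Import all_boot all_algebra.
From mathcomp Require Import boolp.

Set Implicit Arguments.
Unset Strict Implicit.
Unset Printing Implicit Defensive.
Import GRing.Theory.
Local Open Scope ring_scope.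
Local Open Scope quotient_scope.

Section Hom.
Variables (k : fieldType) (U V : lmodType k).

HB.instance Definition _ := gen_eqMixin {linear U -> V}.
HB.instance Definition _ := gen_choiceMixin {linear U -> V}.

Lemma lin_ext (f g : {linear U -> V}) : f =1 g -> f = g.
Proof.
case: f g => f [[fA] [fZ]] [g [[gA] [gZ]]] /= fg.
have {}fg : f = g by exact: funext.
case: _ / fg in gA gZ *; congr GRing.Linear.Pack.
by congr GRing.Linear.Class; [congr Algebra.isNmodMorphism.Axioms_|congr GRing.isScalable.Axioms_];
  apply: Prop_irrelevance.
Qed.

Definition mklin (f : U -> V) (fL : linear f) : {linear U -> V} :=
  HB.pack f (GRing.isLinear.Build k U V *:%R f fL).

Let hzero : {linear U -> V} := \0.
Let hadd (f g : {linear U -> V}) : {linear U -> V} := f \+ g.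
Let hopp (f : {linear U -> V}) : {linear U -> V} := \- f.
Let hscale (a : k) (f : {linear U -> V}) : {linear U -> V} := a \*: f.

Lemma haddA : associative hadd.
Proof. by move=> f g h; apply: lin_ext => x /=; rewrite addrA. Qed.
Lemma haddC : commutative hadd.
Proof. by move=> f g; apply: lin_ext => x /=; rewrite addrC. Qed.
Lemma hadd0 : left_id hzero hadd.
Proof. by move=> f; apply: lin_ext => x /=; rewrite add0r. Qed.
Lemma haddN : left_inverse hzero hopp hadd.
Proof. by move=> f; apply: lin_ext => x /=; rewrite addNr. Qed.
HB.instance Definition _ :=
  GRing.isZmodule.Build {linear U -> V} haddA haddC hadd0 haddN.

Lemma hscaleA a b f : hscale a (hscale b f) = hscale (a * b) f.
Proof. by apply: lin_ext => x /=; rewrite scalerA. Qed.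
Lemma hscale1 : left_id 1 hscale.
Proof. by move=> f; apply: lin_ext => x /=; rewrite scale1r. Qed.
Lemma hscaleDr : right_distributive hscale +%R.
Proof. by move=> a f g; apply: lin_ext => x /=; rewrite scalerDr. Qed.
Lemma hscaleDl f : {morph hscale^~ f : a b / a + b}.
Proof. by move=> a b; apply: lin_ext => x /=; rewrite scalerDl. Qed.
HB.instance Definition _ :=
  GRing.Zmodule_isLmodule.Build k {linear U -> V} hscaleA hscale1 hscaleDr hscaleDl.

Lemma lin0E x : (0 : {linear U -> V}) x = 0. Proof. by []. Qed.
Lemma linDE (f g : {linear U -> V}) x : (f + g) x = f x + g x. Proof. by []. Qed.
Lemma linBE (f g : {linear U -> V}) x : (f - g) x = f x - g x. Proof. by []. Qed.
Lemma linZE a (f : {linear U -> V}) x : (a *: f) x = a *: f x. Proof. by []. Qed.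
Lemma lin_sumE I (r : seq I) (P : pred I) (F : I -> {linear U -> V}) x :
  (\sum_(i <- r | P i) F i) x = \sum_(i <- r | P i) F i x.
Proof. by elim/big_rec2: _ => // i f g _ <-. Qed.
End Hom.

Arguments mklin {k U V} f fL.

Section Tensor.
Variables (k : fieldType) (U V : lmodType k).

Definition bilin (W : lmodType k) (f : U -> V -> W) : Prop :=
  (forall v, linear (f^~ v)) /\ (forall u, linear (f u)).

Definition tsum (W : lmodType k) (f : U -> V -> W) (s : seq (U * V)) : W :=
  \sum_(p <- s) f p.1 p.2.

(* A tensor is a formal sum u_1 (x) v_1 + ... + u_n (x) v_n; two formal sums are
   identified when no bilinear map separates them (see [tensor_univ]). *)
Definition teq (s t : seq (U * V)) : bool :=
  `[< forall (W : lmodType k) (f : U -> V -> W), bilin f -> tsum f s = tsum f t >].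

Lemma teq_refl : reflexive teq. Proof. by move=> s; apply/asboolP. Qed.
Lemma teq_sym : symmetric teq.
Proof.
suff H s t : teq s t -> teq t s by move=> s t; apply/idP/idP; apply: H.
by move=> /asboolP st; apply/asboolP => W f fB; rewrite st.
Qed.
Lemma teq_trans : transitive teq.
Proof.
move=> t s u /asboolP st /asboolP tu; apply/asboolP => W f fB.
by rewrite st // tu.
Qed.
Definition teq_equiv := EquivRel teq teq_refl teq_sym teq_trans.

Definition tensor : Type := {eq_quot teq_equiv}.
HB.instance Definition _ := EqQuotient.on tensor.
HB.instance Definition _ := Choice.on tensor.

Definition tclass (s : seq (U * V)) : tensor := \pi_tensor s.
Definition tens (u : U) (v : V) : tensor := tclass [:: (u, v)].

Definition tlift (W : lmodType k) (f : U -> V -> W) (t : tensor) : W :=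
  tsum f (repr t).

Lemma tlift_class (W : lmodType k) (f : U -> V -> W) s :
  bilin f -> tlift f (tclass s) = tsum f s.
Proof.
move=> fB; rewrite /tlift /tclass.
have /eqmodP/asboolP/(_ W f fB) := reprK (\pi_tensor s).
exact.
Qed.

Lemma tclass_eq s t :
  (forall (W : lmodType k) (f : U -> V -> W), bilin f -> tsum f s = tsum f t) ->
  tclass s = tclass t.
Proof. by move=> st; apply/eqmodP/asboolP. Qed.

Lemma tclassK t : tclass (repr t) = t. Proof. exact: reprK. Qed.

Let tadd (s t : tensor) := tclass (repr s ++ repr t).
Let tscale (a : k) (t : tensor) := tclass [seq (a *: p.1, p.2) | p <- repr t].
Let topp (t : tensor) := tscale (- 1) t.
Let tzero := tclass [::].

Lemma tsum_scale a (W : lmodType k) (f : U -> V -> W) s : bilin f ->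
  tsum f [seq (a *: p.1, p.2) | p <- s] = a *: tsum f s.
Proof.
move=> [fl _]; rewrite /tsum big_map scaler_sumr; apply: eq_bigr => p _ /=.
have := fl p.2 a p.1 0; have := fl p.2 (-1) 0 0 => /=.
by rewrite scaler0 !addr0 scaleN1r addNr => ->; rewrite addr0.
Qed.

Lemma tclass_ext (t1 t2 : tensor) :
  (forall (W : lmodType k) (f : U -> V -> W), bilin f -> tlift f t1 = tlift f t2) ->
  t1 = t2.
Proof. by move=> E; rewrite -[t1]tclassK -[t2]tclassK; apply: tclass_eq. Qed.

Lemma tlift_add (W : lmodType k) (f : U -> V -> W) s t : bilin f ->
  tlift f (tadd s t) = tlift f s + tlift f t.
Proof. by move=> fB; rewrite tlift_class // /tsum big_cat. Qed.
Lemma tlift_scale (W : lmodType k) (f : U -> V -> W) a t : bilin f ->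
  tlift f (tscale a t) = a *: tlift f t.
Proof. by move=> fB; rewrite tlift_class // tsum_scale. Qed.
Lemma tlift_zero (W : lmodType k) (f : U -> V -> W) : bilin f -> tlift f tzero = 0.
Proof. by move=> fB; rewrite tlift_class // /tsum big_nil. Qed.

Lemma taddA : associative tadd.
Proof. by move=> *; apply: tclass_ext => W f fB; rewrite !tlift_add // addrA. Qed.
Lemma taddC : commutative tadd.
Proof. by move=> *; apply: tclass_ext => W f fB; rewrite !tlift_add // addrC. Qed.
Lemma tadd0 : left_id tzero tadd.
Proof.
by move=> *; apply: tclass_ext => W f fB; rewrite tlift_add // tlift_zero // add0r.
Qed.
Lemma taddN : left_inverse tzero topp tadd.
Proof.
move=> t; apply: tclass_ext => W f fB.
by rewrite tlift_add // tlift_scale // tlift_zero // scaleN1r addNr.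
Qed.
HB.instance Definition _ := GRing.isZmodule.Build tensor taddA taddC tadd0 taddN.

Lemma tscaleA a b t : tscale a (tscale b t) = tscale (a * b) t.
Proof. by apply: tclass_ext => W f fB; rewrite !tlift_scale // scalerA. Qed.
Lemma tscale1 : left_id 1 tscale.
Proof. by move=> t; apply: tclass_ext => W f fB; rewrite tlift_scale // scale1r. Qed.
Lemma tscaleDr : right_distributive tscale +%R.
Proof.
move=> a s t; apply: tclass_ext => W f fB.
by rewrite tlift_scale // !tlift_add // !tlift_scale // scalerDr.
Qed.
Lemma tscaleDl t : {morph tscale^~ t : a b / a + b}.
Proof.
move=> a b; apply: tclass_ext => W f fB.
by rewrite tlift_scale // tlift_add // !tlift_scale // scalerDl.
Qed.
HB.instance Definition _ :=
  GRing.Zmodule_isLmodule.Build k tensor tscaleA tscale1 tscaleDr tscaleDl.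

Lemma tlift_linear (W : lmodType k) (f : U -> V -> W) : bilin f -> linear (tlift f).
Proof. by move=> fB a s t; rewrite tlift_add // tlift_scale. Qed.

Lemma tliftE (W : lmodType k) (f : U -> V -> W) u v : bilin f -> tlift f (tens u v) = f u v.
Proof. by move=> fB; rewrite tlift_class // /tsum big_seq1. Qed.

Lemma tens_bilin : bilin tens.
Proof.
by split=> [v a x y|u a x y]; apply: tclass_ext => W f fB;
  rewrite (tlift_linear fB) !tliftE //; case: fB => fl fr; rewrite (fl, fr).
Qed.

Lemma tsum_tens s : tsum tens s = tclass s.
Proof.
elim: s => [|p s IHs]; first by rewrite /tsum big_nil.
rewrite /tsum big_cons -/(tsum _ _) IHs; apply: tclass_ext => W f fB.
by rewrite tlift_add // tliftE // !tlift_class // /tsum big_cons.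
Qed.

Lemma tensE t : tlift tens t = t.
Proof. by rewrite /tlift tsum_tens tclassK. Qed.

Lemma tensor_ext (W : lmodType k) (f g : {linear tensor -> W}) :
  (forall u v, f (tens u v) = g (tens u v)) -> f =1 g.
Proof.
move=> fg t; rewrite -[t]tensE /tlift /tsum !raddf_sum.
by apply: eq_bigr => p _; apply: fg.
Qed.

Theorem tensor_univ (W : lmodType k) (f : U -> V -> W) : bilin f ->
  exists! g : {linear tensor -> W}, forall u v, g (tens u v) = f u v.
Proof.
move=> fB; exists (mklin _ (tlift_linear fB)); split=> [u v|g gE] /=.
  exact: tliftE.
by apply/lin_ext/tensor_ext => u v /=; rewrite gE tliftE.
Qed.


End Tensor.

Arguments tens {k U V} u v.
Arguments tlift {k U V W} f t.

Notation "U ⊗ V" := (tensor U V) (at level 40, left associativity) : type_scope.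
Notation "u ⊗ v" := (tens u v) (at level 40, left associativity) : ring_scope.

(* Sweedler sums: [\sw_(a, b <- t) F] is the sum of the F a b over a chosen way of
   writing the tensor t as a sum of a ⊗ b's; by [tliftE] and [tlift_linear] this
   does not depend on the choice when F is bilinear in a and b. *)
Notation "\sw_ ( a , b <- t ) F" := (tlift (fun a b => F) t)
  (at level 41, F at level 41, a binder, b binder, t at level 200,
   format "'[' \sw_ ( a ,  b  <-  t ) '/  '  F ']'") : ring_scope.

Section Coker.
Variables (k : fieldType) (U V : lmodType k) (f : {linear U -> V}).

Definition limage : {pred V} := fun v => `[< exists u, v = f u >].
Lemma limage_zmod : zmod_closed limage.
Proof.
split=> [|x y /asboolP[u ->] /asboolP[v ->]]; apply/asboolP.
  by exists 0; rewrite linear0.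
by exists (u - v); rewrite linearB.
Qed.
HB.instance Definition _ := GRing.isZmodClosed.Build V limage limage_zmod.

Definition coker : Type := {ideal_quot limage}.
HB.instance Definition _ := GRing.Zmodule.on coker.

Let qpi (v : V) : coker := \pi_({ideal_quot limage}) v.
Let qrep (q : coker) : V := repr (q : {ideal_quot limage}).

Lemma qrepK q : qpi (qrep q) = q. Proof. exact: reprK. Qed.
Lemma qpiD x y : qpi (x + y) = qpi x + qpi y.
Proof. exact: (raddfD \pi_({ideal_quot limage})). Qed.
Lemma qpiP v w : qpi v = qpi w <-> exists u, v - w = f u.
Proof.
split=> [/eqP|[u E]]; rewrite /qpi.
  by rewrite -Quotient.idealrBE => /asboolP.
by apply/eqP; rewrite -Quotient.idealrBE; apply/asboolP; exists u.
Qed.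

Let qscale (a : k) (q : coker) : coker := qpi (a *: qrep q).
Lemma qscale_pi a v : qscale a (qpi v) = qpi (a *: v).
Proof.
have [u E] := (qpiP _ _).1 (qrepK (qpi v)).
by apply/qpiP; exists (a *: u); rewrite -scalerBr E linearZ.
Qed.
Lemma qscaleA a b t : qscale a (qscale b t) = qscale (a * b) t.
Proof. by rewrite -[t]qrepK !qscale_pi scalerA. Qed.
Lemma qscale1 : left_id 1 qscale.
Proof. by move=> t; rewrite -[t]qrepK !qscale_pi scale1r. Qed.
Lemma qscaleDr : right_distributive qscale +%R.
Proof.
move=> a s t; rewrite -[s]qrepK -[t]qrepK -qpiD !qscale_pi.
by rewrite scalerDr qpiD.
Qed.
Lemma qscaleDl t : {morph qscale^~ t : a b / a + b}.
Proof. by move=> a b; rewrite -[t]qrepK !qscale_pi scalerDl qpiD. Qed.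
HB.instance Definition _ :=
  GRing.Zmodule_isLmodule.Build k coker qscaleA qscale1 qscaleDr qscaleDl.

Lemma qpi_linear : linear qpi.
Proof. by move=> a x y; rewrite qpiD -qscale_pi. Qed.
Definition cokerpi : {linear V -> coker} := mklin qpi qpi_linear.

Lemma cokerpi_surj q : exists v, q = cokerpi v.
Proof. by exists (qrep q); rewrite [cokerpi _]qrepK. Qed.
Lemma cokerpi_eq0 v : cokerpi v = 0 <-> exists u, v = f u.
Proof.
rewrite -[0 in X in X <-> _](linear0 cokerpi).
by split=> [/qpiP|[u E]]; [rewrite subr0|apply/qpiP; exists u; rewrite subr0].
Qed.
Lemma cokerpi0 u : cokerpi (f u) = 0.
Proof. by apply/cokerpi_eq0; exists u. Qed.

Section Lift.
Variables (W : lmodType k) (g : {linear V -> W}) (g0 : forall u, g (f u) = 0).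
Lemma coker_rep v : g (qrep (qpi v)) = g v.
Proof.
have [u E] := (qpiP _ _).1 (qrepK (qpi v)).
by apply/eqP; rewrite -subr_eq0 -linearB E g0.
Qed.
Lemma coker_lift_linear : linear (fun q => g (qrep q)).
Proof.
move=> a p q; rewrite -[p]qrepK -[q]qrepK -qpi_linear !coker_rep.
by rewrite linearP.
Qed.
Definition coker_lift : {linear coker -> W} := mklin _ coker_lift_linear.
Lemma coker_liftE v : coker_lift (cokerpi v) = g v. Proof. exact: coker_rep. Qed.
End Lift.

Lemma coker_ext (W : lmodType k) (g h : {linear coker -> W}) :
  (forall v, g (cokerpi v) = h (cokerpi v)) -> g =1 h.
Proof. by move=> gh q; have [v ->] := cokerpi_surj q. Qed.
End Coker.

Section Lin.
Variables (k : fieldType).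
Implicit Types U V W X Y : lmodType k.

Lemma lin_id U : linear (fun x : U => x). Proof. by []. Qed.
Lemma lin_app U V W (g : {linear V -> W}) (f : U -> V) :
  linear f -> linear (fun x => g (f x)).
Proof. by move=> fL a x y; rewrite fL linearP. Qed.
Lemma lin_comp U V W (g : V -> W) (f : U -> V) :
  linear g -> linear f -> linear (fun x => g (f x)).
Proof. by move=> gL fL a x y; rewrite fL gL. Qed.
Lemma lin_eval U V W (f : U -> {linear V -> W}) v :
  linear f -> linear (fun x => f x v).
Proof. by move=> fL a x y; rewrite fL. Qed.
Lemma lin_mull U (A : algType k) (f : U -> A) c :
  linear f -> linear (fun x => f x * c).
Proof. by move=> fL a x y; rewrite fL mulrDl scalerAl. Qed.
Lemma lin_mulr U (A : algType k) (f : U -> A) c :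
  linear f -> linear (fun x => c * f x).
Proof. by move=> fL a x y; rewrite fL mulrDr scalerAr. Qed.
Lemma lin_scaler U V (f : U -> V) (c : k) :
  linear f -> linear (fun x => c *: f x).
Proof. by move=> fL a x y; rewrite fL scalerDr !scalerA mulrC. Qed.
Lemma lin_scalar U V W (e : {scalar V}) (f : U -> V) (w : W) :
  linear f -> linear (fun x => e (f x) *: w).
Proof. by move=> fL a x y; rewrite fL linearP scalerDl scalerA. Qed.
Lemma lin_tensl U V W (f : U -> V) (w : W) : linear f -> linear (fun x => f x ⊗ w).
Proof. by move=> fL a x y; rewrite fL (tens_bilin V W).1. Qed.
Lemma lin_tensr U V W (f : U -> V) (w : W) : linear f -> linear (fun x => w ⊗ f x).
Proof. by move=> fL a x y; rewrite fL (tens_bilin W V).2. Qed.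
Lemma lin_sw_body U V W X (F : U -> V -> W -> X) t :
  (forall a b, linear (fun x => F x a b)) -> linear (fun x => tlift (F x) t).
Proof.
move=> FL a x y; rewrite /tlift /tsum scaler_sumr -big_split.
by apply: eq_bigr => p _; rewrite FL.
Qed.
Lemma lin_sw_arg U V W X (F : V -> W -> X) (f : U -> V ⊗ W) :
  bilin F -> linear f -> linear (fun x => tlift F (f x)).
Proof. by move=> FB fL a x y; rewrite fL tlift_linear. Qed.

Lemma lin_Z U V (f : U -> V) a x : linear f -> f (a *: x) = a *: f x.
Proof. by move=> fL; apply: (linearZZ (mklin _ fL)). Qed.

Lemma lin_mk U V W (f : U -> V -> W) (fL : forall x, linear (f x)) :
  (forall y, linear (fun x => f x y)) -> linear (fun x => mklin (f x) (fL x)).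
Proof. by move=> fL' a x y; apply: lin_ext => z /=; rewrite fL'. Qed.
Lemma lin_coker_lift U V W X (d : {linear V -> W}) (g : U -> {linear W -> X})
    (g0 : forall x u, g x (d u) = 0) :
  linear g -> linear (fun x => coker_lift (g0 x)).
Proof.
move=> gL a x y; apply/lin_ext/coker_ext => v.
by rewrite linDE linZE !coker_liftE gL.
Qed.

Lemma linear_mk U V (f : U -> V) (fL : linear f) x : mklin f fL x = f x.
Proof. by []. Qed.
End Lin.

(* [lin] proves [linear f] and [bilin f] by recursion on the body of f. *)
Ltac lin_hook f := fail.
Ltac lin :=
  intros;
  lazymatch goal with
  | |- bilin _ => split; lin
  | |- GRing.linear_for _ ?f =>
    let f' := eval cbv beta in f in change (linear f'); lin1 f'
  end
with lin1 f :=
  match f with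
  | _ => solve [auto]
  | (fun x => x) => exact: lin_id
  | (fun x => @tlift _ _ _ _ (@?F x) ?t) => apply (@lin_sw_body _ _ _ _ _ F t); lin
  | (fun x => @tlift _ _ _ _ ?F (@?g x)) => apply (@lin_sw_arg _ _ _ _ _ F g); lin
  | (fun x => (@?g x) * ?c) => apply (@lin_mull _ _ _ g c); lin
  | (fun x => ?c * (@?g x)) => apply (@lin_mulr _ _ _ g c); lin
  | (fun x => (@?g x) ⊗ ?c) => apply (@lin_tensl _ _ _ _ g c); lin
  | (fun x => ?c ⊗ (@?g x)) => apply (@lin_tensr _ _ _ _ g c); lin
  | (fun x => GRing.Linear.sort ?e (@?g x) *: ?c) => apply (@lin_scalar _ _ _ _ e g c); lin
  | (fun x => ?c *: (@?g x)) => apply (@lin_scaler _ _ _ g c); lin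
  | (fun x => @GRing.Linear.sort _ _ _ _ ?h (@?g x)) => apply (@lin_app _ _ _ _ h g); lin
  | (fun x => @GRing.Linear.sort _ _ _ _ (@?h x) ?v) => apply (@lin_eval _ _ _ _ h v); lin
  | (fun x => @mklin _ _ _ (@?g x) (@?p x)) => apply (@lin_mk _ _ _ _ g p); lin
  | (fun x => @coker_lift _ _ _ _ _ (@?g x) (@?p x)) =>
      apply (@lin_coker_lift _ _ _ _ _ _ g p); lin
  | _ => lin_hook f
  | (fun x => ?F (@?g x)) => apply (@lin_comp _ _ _ _ F g); [solve [auto]|lin]
  | (fun x => ?F (@?g x) ?c) =>
      apply (@lin_comp _ _ _ _ (fun y => F y c) g); [solve [auto]|lin]
  | (fun x => ?F (@?g x) ?c ?d) =>
      apply (@lin_comp _ _ _ _ (fun y => F y c d) g); [solve [auto]|lin]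
  | (fun x => ?F (@?g x) ?c ?d ?e) =>
      apply (@lin_comp _ _ _ _ (fun y => F y c d e) g); [solve [auto]|lin]
  | (fun x => ?F (@?g x) ?c ?d ?e ?i) =>
      apply (@lin_comp _ _ _ _ (fun y => F y c d e i) g); [solve [auto]|lin]
  end.

Section Sw.
Variables (k : fieldType).
Implicit Types U V W X Y : lmodType k.
Lemma eq_sw U V W (F G : U -> V -> W) t :
  (forall a b, F a b = G a b) -> tlift F t = tlift G t.
Proof. by move=> FG; apply: eq_bigr => p _. Qed.
Lemma linear_sw U V W X (g : {linear W -> X}) (F : U -> V -> W) t :
  g (tlift F t) = \sw_(a, b <- t) g (F a b).
Proof. exact: raddf_sum. Qed.
Lemma lin_sw U V W X (g : W -> X) (F : U -> V -> W) t : linear g ->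
  g (tlift F t) = \sw_(a, b <- t) g (F a b).
Proof. by move=> gL; apply: (linear_sw (mklin _ gL)). Qed.
Lemma sw_sw U V W X Y (F : U -> V -> W) (G : X -> Y -> U ⊗ V) t : bilin F ->
  tlift F (tlift G t) = \sw_(a, b <- t) tlift F (G a b).
Proof. by move=> FB; apply: (lin_sw _ _ (tlift_linear FB)). Qed.
Lemma sw_exch U V W X Y (F : U -> V -> W -> X -> Y) s t :
  \sw_(a, b <- s) \sw_(c, d <- t) F a b c d =
  \sw_(c, d <- t) \sw_(a, b <- s) F a b c d.
Proof. exact: exchange_big. Qed.
Lemma sw_scale U V W (F : U -> V -> W) t (c : k) :
  \sw_(a, b <- t) (c *: F a b) = c *: tlift F t.
Proof. by rewrite /tlift /tsum scaler_sumr. Qed.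
Lemma sw_tens_ext U V (t s : U ⊗ V) :
  (forall W (F : U -> V -> W), bilin F -> tlift F t = tlift F s) -> t = s.
Proof. by move=> E; rewrite -[t]tensE -[s]tensE; apply/E/tens_bilin. Qed.
End Sw.

(* The underlying algebra of a Hopf algebra over a field is never trivial
   ([counit1]), so the nontriviality built into [algType] is no restriction. *)
Record hopfAlg (k : fieldType) := HopfAlg {
  hopf_alg :> algType k;
  Delta : {linear hopf_alg -> (hopf_alg ⊗ hopf_alg)%type};
  counit : {scalar hopf_alg};
  antipode : {linear hopf_alg -> hopf_alg};
  coassoc : forall h,
    \sw_(a, b <- Delta h) \sw_(c, d <- Delta a) c ⊗ (d ⊗ b) =
    \sw_(a, b <- Delta h) \sw_(c, d <- Delta b) a ⊗ (c ⊗ d);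
  counitl : forall h, \sw_(a, b <- Delta h) counit a *: b = h;
  counitr : forall h, \sw_(a, b <- Delta h) counit b *: a = h;
  DeltaM : forall x y, Delta (x * y) =
    \sw_(a, b <- Delta x) \sw_(c, d <- Delta y) (a * c) ⊗ (b * d);
  Delta1 : Delta 1 = 1 ⊗ 1;
  counitM : forall x y, counit (x * y) = counit x * counit y;
  counit1 : counit 1 = 1;
  antipodel : forall h, \sw_(a, b <- Delta h) antipode a * b = counit h *: 1;
  antipoder : forall h, \sw_(a, b <- Delta h) a * antipode b = counit h *: 1
}.
Arguments Delta {k h} : rename.
Arguments counit {k h} : rename.
Arguments antipode {k h} : rename.

(* Sums over the iterated coproduct h^1 ⊗ h^2 ⊗ h^3 of h. *)
Notation "\sw3_ ( a , b , c <- h ) F" :=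
  (\sw_(a, t <- Delta h) \sw_(b, c <- Delta t) F)
  (at level 41, F at level 41, a binder, b binder, c binder, h at level 200,
   format "'[' \sw3_ ( a ,  b ,  c  <-  h ) '/  '  F ']'") : ring_scope.

Section HopfTheory.
Variables (k : fieldType) (H : hopfAlg k).
Implicit Types (x y h : H) (W : lmodType k).
Local Notation S := antipode.
Local Notation eps := counit.

Lemma swA W (F : H -> H -> H -> W) h :
  (forall b c, linear (fun a => F a b c)) -> (forall a c, linear (fun b => F a b c)) ->
  (forall a b, linear (F a b)) ->
  \sw_(a, b <- Delta h) \sw_(c, d <- Delta a) F c d b =
  \sw_(a, b <- Delta h) \sw_(c, d <- Delta b) F a c d.
Proof.
move=> F1 F2 F3.
pose G t := \sw_(a, s <- t) \sw_(b, c <- s) F a b c.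
have FB a : bilin (F a) by lin.
have GB : bilin (fun a s => \sw_(b, c <- s) F a b c) by lin.
have GL : linear G by rewrite /G; lin.
have GE a b c : G (a ⊗ (b ⊗ c)) = F a b c by rewrite /G !tliftE.
have := congr1 G (coassoc h); rewrite !(lin_sw _ _ GL).
under eq_sw => a b. rewrite (lin_sw _ _ GL). under eq_sw => c d do rewrite GE. over.
move=> ->.
under eq_sw => a b. rewrite (lin_sw _ _ GL). under eq_sw => c d do rewrite GE. over.
by [].
Qed.

Lemma sw_counitl W (F : H -> W) h : linear F -> \sw_(a, b <- Delta h) eps a *: F b = F h.
Proof.
move=> FL; rewrite -[in RHS](counitl h) (lin_sw _ _ FL); apply: eq_sw => a b.
by rewrite lin_Z.
Qed.
Lemma sw_counitr W (F : H -> W) h : linear F -> \sw_(a, b <- Delta h) eps b *: F a = F h.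
Proof.
move=> FL; rewrite -[in RHS](counitr h) (lin_sw _ _ FL); apply: eq_sw => a b.
by rewrite lin_Z.
Qed.
Lemma sw_Sl W (F : H -> W) h : linear F -> \sw_(a, b <- Delta h) F (S a * b) = eps h *: F 1.
Proof.
move=> FL; rewrite -(lin_sw _ _ FL) antipodel; exact: lin_Z.
Qed.
Lemma sw_Sr W (F : H -> W) h : linear F -> \sw_(a, b <- Delta h) F (a * S b) = eps h *: F 1.
Proof.
move=> FL; rewrite -(lin_sw _ _ FL) antipoder; exact: lin_Z.
Qed.

Lemma sw_Sl3 W (F : H -> H -> W) h : bilin F ->
  \sw3_(a, b, c <- h) F (S a * b) c = F 1 h.
Proof.
move=> [F1 F2]; rewrite -(@swA _ (fun a b c => F (S a * b) c)); try lin.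
under eq_sw => a b do rewrite (@sw_Sl _ (F^~ b)) //.
exact: sw_counitl.
Qed.
Lemma sw_Sr3 W (F : H -> H -> W) h : bilin F ->
  \sw3_(a, b, c <- h) F (a * S b) c = F 1 h.
Proof.
move=> [F1 F2]; rewrite -(@swA _ (fun a b c => F (a * S b) c)); try lin.
under eq_sw => a b do rewrite (@sw_Sr _ (F^~ b)) //.
exact: sw_counitl.
Qed.
Lemma sw_3Sl W (F : H -> H -> W) h : bilin F ->
  \sw3_(a, b, c <- h) F a (S b * c) = F h 1.
Proof.
move=> [F1 F2].
under eq_sw => a b do rewrite (@sw_Sl _ (F a)) //.
exact: (@sw_counitr _ (F^~ 1)).
Qed.
Lemma sw_3Sr W (F : H -> H -> W) h : bilin F ->
  \sw3_(a, b, c <- h) F a (b * S c) = F h 1.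
Proof.
move=> [F1 F2].
under eq_sw => a b do rewrite (@sw_Sr _ (F a)) //.
exact: (@sw_counitr _ (F^~ 1)).
Qed.

Lemma sw_DeltaM W (F : H -> H -> W) x y : bilin F ->
  \sw_(a, b <- Delta (x * y)) F a b =
  \sw_(a, b <- Delta x) \sw_(c, d <- Delta y) F (a * c) (b * d).
Proof.
move=> FB; rewrite DeltaM sw_sw //; apply: eq_sw => a b.
by rewrite sw_sw //; apply: eq_sw => c d; rewrite tliftE.
Qed.

Lemma antipode1 : S (1 : H) = 1.
Proof.
have := antipodel (1 : H); rewrite Delta1 tliftE; last by lin.
by rewrite counit1 scale1r mulr1.
Qed.
End HopfTheory.
(* The bundled linear map x |-> E. *)
Notation "\lin x => E" := (mklin (fun x => E) ltac:(lin))
  (at level 200, x binder, only parsing) : ring_scope.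
Notation "\lin x => E" := (mklin (fun x => E) _)
  (at level 200, x binder, only printing) : ring_scope.

Section AntipodeTheory.
Variables (k : fieldType) (H : hopfAlg k).
Implicit Types (x y h : H) (W : lmodType k).
Local Notation S := antipode.
Local Notation eps := counit.

Lemma antipodeM x y : S (x * y) = S y * S x.
Proof.
pose E (x1 y1 x2 y2 x3 y3 : H) := S (x1 * y1) * (x2 * y2) * (S y3 * S x3).
have E1 : \sw3_(x1, x2, x3 <- x) \sw3_(y1, y2, y3 <- y) E x1 y1 x2 y2 x3 y3 = S (x * y).
  transitivity (\sw3_(x1, x2, x3 <- x) (S (x1 * y) * (x2 * S x3))).
    apply: eq_sw => x1 t; apply: eq_sw => x2 x3.
    rewrite -[S x3 in RHS]mul1r -(@sw_3Sr _ _ _ (fun a b => S (x1 * a) * (x2 * (b * S x3)))); last by lin.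
    by do 2!apply: eq_sw => ? ?; rewrite /E !mulrA.
  by rewrite (@sw_3Sr _ _ _ (fun a b => S (a * y) * b)) ?mulr1 //; lin.
rewrite -E1 -(@swA _ _ _ (fun x1 x2 x3 => \sw3_(y1, y2, y3 <- y) E x1 y1 x2 y2 x3 y3));
  try by rewrite /E; lin.
transitivity (\sw_(u, x3 <- Delta x) \sw_(v, y3 <- Delta y)
                 eps v *: (eps u *: (S y3 * S x3))); last first.
  under eq_sw => u x3 do [rewrite (@sw_counitl _ _ _ (fun y3 => eps u *: (S y3 * S x3))); last by lin].
  by rewrite (@sw_counitl _ _ _ (fun x3 => S y * S x3)) //; lin.
apply: eq_sw => u x3.
under eq_sw => x1 x2 do [rewrite -(@swA _ _ _ (fun y1 y2 y3 => E x1 y1 x2 y2 x3 y3));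
  try by rewrite /E; lin].
rewrite sw_exch; apply: eq_sw => v y3.
rewrite /E -(@sw_DeltaM _ _ _ (fun a b => S a * b * (S y3 * S x3))); last by lin.
rewrite (@sw_Sl _ _ _ (fun a => a * (S y3 * S x3))); last by lin.
by rewrite mul1r scalerA counitM mulrC.
Qed.

Definition tmul (s t : H ⊗ H) : H ⊗ H :=
  \sw_(a, b <- s) \sw_(c, d <- t) (a * c) ⊗ (b * d).
Lemma tmulE a b c d : tmul (a ⊗ b) (c ⊗ d) = (a * c) ⊗ (b * d).
Proof. by rewrite /tmul !tliftE //; lin. Qed.
Lemma tmul_bilin : bilin tmul. Proof. by rewrite /tmul; lin. Qed.
Lemma tmull t : linear (tmul^~ t). Proof. exact: tmul_bilin.1. Qed.
Lemma tmulr t : linear (tmul t). Proof. exact: tmul_bilin.2. Qed.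

Lemma tens_ind (U V W : lmodType k) (F G : U ⊗ V -> W) : linear F -> linear G ->
  (forall a b, F (a ⊗ b) = G (a ⊗ b)) -> F =1 G.
Proof. move=> FL GL E; exact: (@tensor_ext _ _ _ _ (mklin _ FL) (mklin _ GL)). Qed.

Lemma tmulA s t u : tmul (tmul s t) u = tmul s (tmul t u).
Proof.
have L1 := tmull; have L2 := tmulr.
apply: (@tens_ind _ _ _ (fun s => tmul (tmul s t) u) (fun s => tmul s (tmul t u))); try lin.
move=> a b.
apply: (@tens_ind _ _ _ (fun t => tmul (tmul (a ⊗ b) t) u)
          (fun t => tmul (a ⊗ b) (tmul t u))); try lin.
move=> c d.
apply: (@tens_ind _ _ _ (tmul (tmul (a ⊗ b) (c ⊗ d)))
          (fun u => tmul (a ⊗ b) (tmul (c ⊗ d) u))); try lin.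
by move=> e f; rewrite !tmulE !mulrA.
Qed.
Lemma tmul1 : left_id (1 ⊗ 1) tmul.
Proof.
have L2 := tmulr.
by apply: (@tens_ind _ _ _ (tmul (1 ⊗ 1)) id); try lin; move=> a b; rewrite tmulE !mul1r.
Qed.
Lemma tmulr1 : right_id (1 ⊗ 1) tmul.
Proof.
have L1 := tmull.
by apply: (@tens_ind _ _ _ (tmul^~ (1 ⊗ 1)) id); try lin; move=> a b; rewrite tmulE !mulr1.
Qed.

Lemma Delta_antipode h : Delta (S h) = \sw_(a, b <- Delta h) S b ⊗ S a.
Proof.
have L1 := tmull; have L2 := tmulr.
pose V h := \sw_(a, b <- Delta h) S (b : H) ⊗ S (a : H).
have VL : linear V by rewrite /V; lin.
have VE x : \sw_(a, b <- Delta x) tmul (Delta a) (V b) = eps x *: (1 ⊗ 1).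
  transitivity (\sw_(a, t <- Delta x) (a * S t) ⊗ (1 : H)); last first.
    by rewrite (@sw_Sr _ _ _ (fun y => y ⊗ 1)) //; lin.
  pose F (a b c d : H) := (a * S d) ⊗ (b * S c).
  transitivity (\sw_(t, c <- Delta x) \sw_(a, b <- Delta t)
                  \sw_(c, d <- Delta c) F a b c d).
    apply: eq_sw => a b; rewrite -[Delta a in LHS]tensE (lin_sw _ _ (L1 _)).
    apply: eq_sw => a1 a2; rewrite (lin_sw _ _ (L2 _)).
    by apply: eq_sw => b1 b2; rewrite tmulE.
  rewrite (@swA _ _ _ (fun a b c => \sw_(c, d <- Delta c) F a b c d)); try by rewrite /F; lin.
  apply: eq_sw => a t; rewrite -(@swA _ _ _ (F a)); try by rewrite /F; lin.
  under eq_sw => u d do [rewrite /F (@sw_Sr _ _ _ (fun y => (a * S d) ⊗ y)); last by lin].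
  by rewrite (@sw_counitl _ _ _ (fun d => (a * S d) ⊗ 1)) //; lin.
pose E a b c := tmul (tmul (Delta (S a)) (Delta b)) (V c).
transitivity (\sw3_(a, b, c <- h) E a b c); last first.
  under eq_sw => a t. under eq_sw => b c do rewrite /E -[tmul (Delta _) _]DeltaM. over.
  by rewrite (@sw_Sl3 _ _ _ (fun p c => tmul (Delta p) (V c))) ?Delta1 ?tmul1 //; lin.
under eq_sw => a t.
  under eq_sw => b c do rewrite /E tmulA.
  rewrite -(lin_sw _ _ (L2 _)) VE lin_Z // tmulr1; over.
by rewrite (@sw_counitr _ _ _ (fun a => Delta (S a))) //; lin.
Qed.

Lemma sw_DeltaS W (F : H -> H -> W) h : bilin F ->
  \sw_(a, b <- Delta (S h)) F a b = \sw_(a, b <- Delta h) F (S b) (S a).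
Proof.
by move=> FB; rewrite Delta_antipode sw_sw //; apply: eq_sw => a b; rewrite tliftE.
Qed.

Section Sw5.
Variables (W : lmodType k) (F : H -> H -> H -> H -> H -> W).
Hypotheses (F1 : forall b c d e, linear (fun a => F a b c d e))
  (F2 : forall a c d e, linear (fun b => F a b c d e))
  (F3 : forall a b d e, linear (fun c => F a b c d e))
  (F4 : forall a b c e, linear (fun d => F a b c d e))
  (F5 : forall a b c d, linear (fun e => F a b c d e)).

Lemma sw_expand h :
  \sw3_(a, b, c <- h) \sw_(a1, a2 <- Delta a) \sw_(c1, c2 <- Delta c) F a1 a2 b c1 c2 =
  \sw3_(a, b, c <- h) \sw3_(b1, b2, b3 <- b) F a b1 b2 b3 c.
Proof.
transitivity (\sw_(a, t <- Delta h) \sw_(a1, a2 <- Delta a) \sw_(b, c <- Delta t)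
   \sw_(c1, c2 <- Delta c) F a1 a2 b c1 c2).
  by apply: eq_sw => a t; rewrite sw_exch.
rewrite (@swA _ _ _ (fun a1 a2 t => \sw_(b, c <- Delta t)
   \sw_(c1, c2 <- Delta c) F a1 a2 b c1 c2)); try lin.
apply: eq_sw => a t.
rewrite (@swA _ _ _ (fun b1 u c => \sw_(b2, b3 <- Delta u) F a b1 b2 b3 c)); try lin.
apply: eq_sw => b1 v.
by rewrite (@swA _ _ _ (fun b2 b3 c => F a b1 b2 b3 c)); try lin.
Qed.

Variables p q : H -> H -> H.
Hypotheses (p1 : forall b, linear (fun a => p a b)) (p2 : forall a, linear (p a))
  (q1 : forall b, linear (fun a => q a b)) (q2 : forall a, linear (q a)).
Hypotheses
  (pE : forall h, \sw_(a, b <- Delta h) p a b = eps h *: 1)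
  (qE : forall h, \sw_(a, b <- Delta h) q a b = eps h *: 1).

Lemma sw_conv (W' : lmodType k) (r : H -> H -> H) (G : H -> H -> W') h :
  (forall b, linear (fun a => r a b)) -> (forall a, linear (r a)) ->
  (forall h, \sw_(a, b <- Delta h) r a b = eps h *: 1) -> bilin G ->
  \sw3_(a, b, c <- h) G (r a b) c = G 1 h.
Proof.
move=> r1 r2 rE [G1 G2]; rewrite -(@swA _ _ _ (fun a b c => G (r a b) c)); try lin.
under eq_sw => a b do rewrite -(lin_sw _ _ (G1 b)) rE (lin_Z _ _ (G1 b)).
exact: sw_counitl.
Qed.

Lemma sw_collapse h :
  \sw3_(a, b, c <- h) \sw3_(b1, b2, b3 <- b)
    \sw_(a1, a2 <- Delta a) \sw_(c1, c2 <- Delta c) F a1 (p a2 b1) b2 (q b3 c1) c2 =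
  \sw3_(a, b, c <- h) F a 1 b 1 c.
Proof.
transitivity (\sw_(a, t <- Delta h) \sw_(a1, a2 <- Delta a) \sw_(b, c <- Delta t)
   \sw3_(b1, b2, b3 <- b) \sw_(c1, c2 <- Delta c) F a1 (p a2 b1) b2 (q b3 c1) c2).
  apply: eq_sw => a t; rewrite sw_exch; apply: eq_sw => b c.
  rewrite [RHS]sw_exch; apply: eq_sw => ? ?.
  by rewrite [RHS]sw_exch; apply: eq_sw => ? ?.
rewrite (@swA _ _ _ (fun a1 a2 t => \sw_(b, c <- Delta t)
   \sw3_(b1, b2, b3 <- b) \sw_(c1, c2 <- Delta c) F a1 (p a2 b1) b2 (q b3 c1) c2)); try lin.
apply: eq_sw => a s.
pose M w v := \sw_(u, c <- Delta v) \sw_(b2, b3 <- Delta u) \sw_(c1, c2 <- Delta c)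
   F a w b2 (q b3 c1) c2.
transitivity (\sw3_(a2, b1, v <- s) M (p a2 b1) v).
  apply: eq_sw => a2 t.
  by rewrite (@swA _ _ _ (fun b1 u c => \sw_(b2, b3 <- Delta u)
    \sw_(c1, c2 <- Delta c) F a (p a2 b1) b2 (q b3 c1) c2)); try lin.
rewrite (sw_conv _ p1 p2 pE); last by rewrite /M; lin.
rewrite /M (@swA _ _ _ (fun b2 b3 c => \sw_(c1, c2 <- Delta c) F a 1 b2 (q b3 c1) c2)); try lin.
by apply: eq_sw => b r; rewrite (@sw_conv _ q (F a 1 b)) //; lin.
Qed.
End Sw5.

Lemma sw3_M W (F : H -> H -> H -> W) x y :
  (forall b c, linear (fun a => F a b c)) -> (forall a c, linear (fun b => F a b c)) ->
  (forall a b, linear (F a b)) ->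
  \sw3_(a, b, c <- x * y) F a b c =
  \sw3_(x1, x2, x3 <- x) \sw3_(y1, y2, y3 <- y) F (x1 * y1) (x2 * y2) (x3 * y3).
Proof.
move=> F1 F2 F3.
rewrite (@sw_DeltaM _ _ _ (fun a t => \sw_(b, c <- Delta t) F a b c)); last by lin.
apply: eq_sw => x1 t; rewrite [RHS]sw_exch; apply: eq_sw => y1 u.
by rewrite sw_DeltaM //; lin.
Qed.

Lemma sw_Delta1 W (F : H -> H -> W) : bilin F -> \sw_(a, b <- Delta 1) F a b = F 1 1.
Proof. by move=> FB; rewrite Delta1 tliftE. Qed.

Lemma sw3_1 W (F : H -> H -> H -> W) :
  (forall b c, linear (fun a => F a b c)) -> (forall a c, linear (fun b => F a b c)) ->
  (forall a b, linear (F a b)) -> \sw3_(a, b, c <- 1) F a b c = F 1 1 1.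
Proof.
move=> F1 F2 F3.
by rewrite (@sw_Delta1 _ (fun a t => \sw_(b, c <- Delta t) F a b c)) ?sw_Delta1 //; lin.
Qed.
End AntipodeTheory.

Record aydMod (k : fieldType) (H : hopfAlg k) := AydMod {
  ayd_mod :> lmodType k;
  mact : {linear H -> {linear ayd_mod -> ayd_mod}};
  mcoact : {linear ayd_mod -> (ayd_mod ⊗ H)%type};
  mact1 : forall m, mact 1 m = m;
  mactM : forall x y m, mact (x * y) m = mact x (mact y m);
  mcoactA : forall m,
    \sw_(n, b <- mcoact m) \sw_(p, a <- mcoact n) p ⊗ (a ⊗ b) =
    \sw_(n, b <- mcoact m) \sw_(c, d <- Delta b) n ⊗ (c ⊗ d);
  mcoact1 : forall m, \sw_(n, b <- mcoact m) counit b *: n = m;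
  ayd_modP : forall h m, mcoact (mact h m) =
    \sw3_(h1, h2, h3 <- h) \sw_(m0, m1 <- mcoact m)
      mact h2 m0 ⊗ (h3 * m1 * antipode h1)
}.
Arguments mact {k H} M : rename.
Arguments mcoact {k H} M : rename.

Definition mstable (k : fieldType) (H : hopfAlg k) (M : aydMod H) : Prop :=
  forall m, \sw_(m0, m1 <- mcoact M m) mact M m1 m0 = m.

Record aydCtr (k : fieldType) (H : hopfAlg k) := AydCtr {
  ayd_ctr :> lmodType k;
  cact : {linear H -> {linear ayd_ctr -> ayd_ctr}};
  calpha : {linear {linear H -> ayd_ctr} -> ayd_ctr};
  cact1 : forall n, cact 1 n = n;
  cactM : forall x y n, cact (x * y) n = cact x (cact y n);
  calphaA : forall f : {linear (H ⊗ H)%type -> ayd_ctr},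
    calpha (\lin x => calpha (\lin h => f (x ⊗ h))) = calpha (\lin h => f (Delta h));
  calpha1 : forall n, calpha (\lin h => counit h *: n) = n;
  ayd_ctrP : forall h f, cact h (calpha f) =
    calpha (\lin x => \sw3_(h1, h2, h3 <- h) cact h2 (f (antipode h3 * x * h1)))
}.
Arguments cact {k H} N : rename.
Arguments calpha {k H} N : rename.

Definition cstable (k : fieldType) (H : hopfAlg k) (N : aydCtr H) : Prop :=
  forall n, calpha N (\lin h => cact N h n) = n.

Section Hat.
Variables (k : fieldType) (H : hopfAlg k) (M : aydMod H).
Local Notation S := antipode.

Definition comod_map : {pred {linear H -> M}} := fun f =>
  `[< forall h, mcoact M (f h) = \sw_(a, b <- Delta h) f a ⊗ b >].

Lemma comod_map_submod : submod_closed comod_map.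
Proof.
split=> [|c f g /asboolP fP /asboolP gP]; apply/asboolP => h.
  rewrite linear0; apply: esym; apply: big1 => p _.
  exact: (linear0 (mklin _ ((tens_bilin _ _).1 _))).
rewrite linDE linZE linearP fP gP -sw_scale -big_split.
by apply: eq_bigr => p _; rewrite linDE linZE (tens_bilin _ _).1.
Qed.
HB.instance Definition _ := GRing.isSubmodClosed.Build k {linear H -> M} comod_map comod_map_submod.

(* Hom(H, M)^H. *)
Record hatT : Type := Hat { hatval : {linear H -> M}; hatP : hatval \in comod_map }.
HB.instance Definition _ := [isSub for hatval].
HB.instance Definition _ := [Choice of hatT by <:].
HB.instance Definition _ := [SubChoice_isSubLmodule of hatT by <:].

Lemma hat_ext (f g : hatT) : (forall h, hatval f h = hatval g h) -> f = g.
Proof. by move=> fg; apply/val_inj/lin_ext. Qed.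
Lemma lin_hatval (U : lmodType k) (f : U -> hatT) : linear f -> linear (fun x => hatval (f x)).
Proof. by move=> fL a x y; rewrite fL. Qed.
Lemma lin_Hat (U : lmodType k) (f : U -> {linear H -> M}) (fP : forall x, f x \in comod_map) :
  linear f -> linear (fun x => Hat (fP x)).
Proof. by move=> fL a x y; apply: val_inj => /=; rewrite fL. Qed.
End Hat.

Ltac lin_hook f ::=
  match f with
  | (fun x => @hatval _ _ _ (@?g x)) => apply (@lin_hatval _ _ _ _ g); lin
  | (fun x => @Hat _ _ _ (@?g x) (@?p x)) => apply (@lin_Hat _ _ _ _ g p); lin
  end.

Section HatAct.
Variables (k : fieldType) (H : hopfAlg k) (M : aydMod H).
Local Notation S := antipode.

Lemma hatE (f : hatT M) h : mcoact M (hatval f h) = \sw_(a, b <- Delta h) hatval f a ⊗ b.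
Proof. by move/asboolP: (hatP f); apply. Qed.

Lemma hat_alpha_subproof (t : {linear H -> hatT M}) :
  (\lin h => \sw_(a, b <- Delta h) hatval (t a) b) \in @comod_map k H M.
Proof.
apply/asboolP => h; rewrite !linear_mk linear_sw.
under eq_sw => a b do rewrite hatE.
rewrite -(@swA _ _ _ (fun a b c => hatval (t a) b ⊗ c)); try lin.
by apply: eq_sw => a b; rewrite linear_mk (lin_sw _ _ ((tens_bilin _ _).1 _)).
Qed.

Definition hat_alpha : {linear {linear H -> hatT M} -> hatT M} :=
  \lin t => Hat (hat_alpha_subproof t).

Lemma hat_act_subproof (h : H) (f : hatT M) :
  (\lin x => \sw3_(h1, h2, h3 <- h) mact M h2 (hatval f (S h3 * x * h1)))
    \in @comod_map k H M.
Proof.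
apply/asboolP => x; rewrite !linear_mk linear_sw.
pose F y a b c d e := mact M c (hatval f (S e * y.1 * a)) ⊗ (d * y.2 * b : H).
transitivity (\sw_(x1, x2 <- Delta x) \sw3_(h1, h2, h3 <- h) F (x1, x2) h1 1 h2 1 h3); last first.
  apply: eq_sw => x1 x2; rewrite linear_mk.
  rewrite (lin_sw _ _ ((tens_bilin _ _).1 _)); apply: eq_sw => h1 t.
  rewrite (lin_sw _ _ ((tens_bilin _ _).1 _)); apply: eq_sw => h2 h3.
  by rewrite /F /= mul1r mulr1.
under [RHS]eq_sw => x1 x2.
  rewrite -(@sw_collapse _ _ _ (F (x1, x2)) _ _ _ _ _ (fun a b => a * S b) (fun a b => a * S b));
   try (by rewrite /F; lin); try exact: antipoder.
  over.
rewrite [RHS]sw_exch; apply: eq_sw => h1 t.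
rewrite linear_sw [RHS]sw_exch; apply: eq_sw => h2 h3.
rewrite ayd_modP [RHS]sw_exch; apply: eq_sw => b1 u.
rewrite [RHS]sw_exch; apply: eq_sw => b2 b3.
rewrite hatE sw_sw; last by lin.
under eq_sw => c d do [rewrite tliftE; last by lin].
rewrite (@sw_DeltaM _ _ _ (fun c d => mact M b2 (hatval f c) ⊗ (b3 * d * S b1))); last by lin.
rewrite (@sw_DeltaM _ _ _ (fun e g => \sw_(c, d <- Delta h1)
  mact M b2 (hatval f (e * c)) ⊗ (b3 * (g * d) * S b1))); last by lin.
rewrite (@sw_DeltaS _ _ _ (fun a b => \sw_(a0, b0 <- Delta x) \sw_(c, d <- Delta h1)
  mact M b2 (hatval f (a * a0 * c)) ⊗ (b3 * (b * b0 * d) * S b1))); last by lin.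
rewrite sw_exch; apply: eq_sw => x1 x2.
rewrite sw_exch; apply: eq_sw => a1 a2; apply: eq_sw => c1 c2.
by rewrite /F /= !mulrA.
Qed.

Definition hat_act : {linear H -> {linear hatT M -> hatT M}} :=
  \lin h => \lin f => Hat (hat_act_subproof h f).

Lemma hat_act1 f : hat_act 1 f = f.
Proof.
apply: hat_ext => x /=.
rewrite (@sw3_1 _ _ _ (fun h1 h2 h3 => mact M h2 (hatval f (S h3 * x * h1)))); try lin.
by rewrite mact1 antipode1 mul1r mulr1.
Qed.

Lemma hat_actM x y f : hat_act (x * y) f = hat_act x (hat_act y f).
Proof.
apply: hat_ext => z /=.
rewrite (@sw3_M _ _ _ (fun h1 h2 h3 => mact M h2 (hatval f (S h3 * z * h1)))); try lin.
apply: eq_sw => x1 t; apply: eq_sw => x2 x3.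
rewrite linear_sw; apply: eq_sw => y1 u.
rewrite linear_sw; apply: eq_sw => y2 y3.
by rewrite mactM antipodeM !mulrA.
Qed.

Lemma hat_alphaA (f : {linear (H ⊗ H)%type -> hatT M}) :
  hat_alpha (\lin x => hat_alpha (\lin h => f (x ⊗ h))) = hat_alpha (\lin h => f (Delta h)).
Proof.
apply: hat_ext => y /=.
rewrite -(@swA _ _ _ (fun a b c => hatval (f (a ⊗ b)) c)); try lin.
apply: eq_sw => a b.
rewrite -{2}[Delta a]tensE (@lin_sw _ _ _ _ _ (fun t => hatval (f t) b)) //; lin.
Qed.

Lemma hat_alpha1 f : hat_alpha (\lin h => counit h *: f) = f.
Proof.
apply: hat_ext => y /=.
by rewrite -[RHS](@sw_counitl _ _ _ (fun x => hatval f x)) //; lin.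
Qed.

Lemma hat_ayd h f : hat_act h (hat_alpha f) =
  hat_alpha (\lin x => \sw3_(h1, h2, h3 <- h) hat_act h2 (f (S h3 * x * h1))).
Proof.
apply: hat_ext => x.
pose F y a b c d e := mact M c (hatval (f (S e * y.1 * a)) (S d * y.2 * b)).
transitivity (\sw_(x1, x2 <- Delta x) \sw3_(h1, h2, h3 <- h)
   \sw3_(g1, g2, g3 <- h2) F (x1, x2) h1 g1 g2 g3 h3); last first.
  apply: eq_sw => x1 x2; rewrite linear_mk.
  rewrite (@lin_sw _ _ _ _ _ (fun t => hatval t x2)); last by lin.
  apply: eq_sw => h1 t.
  rewrite (@lin_sw _ _ _ _ _ (fun t => hatval t x2)); last by lin.
  by [].
under [RHS]eq_sw => x1 x2.
  rewrite -(@sw_expand _ _ _ (F (x1, x2))); try (by rewrite /F; lin).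
  over.
rewrite [RHS]sw_exch; apply: eq_sw => h1 t.
rewrite [RHS]sw_exch; apply: eq_sw => h2 h3.
rewrite linear_mk linear_sw.
rewrite (@sw_DeltaM _ _ _ (fun c d => mact M h2 (hatval (f c) d))); last by lin.
rewrite (@sw_DeltaM _ _ _ (fun e g => \sw_(c, d <- Delta h1)
  mact M h2 (hatval (f (e * c)) (g * d)))); last by lin.
rewrite (@sw_DeltaS _ _ _ (fun a b => \sw_(a0, b0 <- Delta x) \sw_(c, d <- Delta h1)
  mact M h2 (hatval (f (a * a0 * c)) (b * b0 * d)))); last by lin.
rewrite sw_exch; apply: eq_sw => x1 x2.
by rewrite sw_exch.
Qed.

Definition hatH : aydCtr H :=
  AydCtr hat_act1 hat_actM hat_alphaA hat_alpha1 hat_ayd.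
End HatAct.

Section Odot.
Variables (k : fieldType) (H : hopfAlg k) (N : aydCtr H).
Local Notation S := antipode.

(* H ⊙_H N is the cokernel of the difference of [odot_l] and [odot_r]; the class
   of h ⊗ n is [odot_cls h n]. *)
Definition odot_l : {linear (H ⊗ {linear H -> N})%type -> (H ⊗ N)%type} :=
  \lin t => \sw_(h, f <- t) h ⊗ calpha N f.
Definition odot_r : {linear (H ⊗ {linear H -> N})%type -> (H ⊗ N)%type} :=
  \lin t => \sw_(h, (f : {linear H -> N}) <- t) \sw_(h1, h2 <- Delta h) h2 ⊗ f h1.

Definition odot : Type := coker (odot_l - odot_r).
HB.instance Definition _ := GRing.Lmodule.on odot.
Definition odot_cls (h : H) (n : N) : odot := cokerpi (odot_l - odot_r) (h ⊗ n).

Lemma odot_clsl (U : lmodType k) (f : U -> H) n : linear f -> linear (fun x => odot_cls (f x) n).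
Proof. by move=> fL; rewrite /odot_cls; lin. Qed.
Lemma odot_clsr (U : lmodType k) h (f : U -> N) : linear f -> linear (fun x => odot_cls h (f x)).
Proof. by move=> fL; rewrite /odot_cls; lin. Qed.
End Odot.

Ltac lin_hook f ::=
  match f with
  | (fun x => @hatval _ _ _ (@?g x)) => apply (@lin_hatval _ _ _ _ g); lin
  | (fun x => @Hat _ _ _ (@?g x) (@?p x)) => apply (@lin_Hat _ _ _ _ g p); lin
  | (fun x => @odot_cls _ _ _ (@?g x) ?n) => apply (@odot_clsl _ _ _ _ g n); lin
  | (fun x => @odot_cls _ _ _ ?h (@?g x)) => apply (@odot_clsr _ _ _ _ h g); lin
  end.

Section Prime.
Variables (k : fieldType) (H : hopfAlg k) (N : aydCtr H).
Local Notation S := antipode.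
Local Notation "[ h , n ]" := (odot_cls (N := N) h n).

Lemma odot_rel h f : [h, calpha N f] = \sw_(h1, h2 <- Delta h) [h2, f h1].
Proof.
have := cokerpi0 (odot_l N - odot_r N) (h ⊗ f).
rewrite linBE linearB [odot_l _ _]linear_mk [odot_r _ _]linear_mk !tliftE; try lin.
move/eqP; rewrite subr_eq0 => /eqP. by rewrite linear_sw.
Qed.

Lemma odot_descend (W : lmodType k) (g : {linear (H ⊗ N)%type -> W}) :
  (forall h f, g (h ⊗ calpha N f) = \sw_(h1, h2 <- Delta h) g (h2 ⊗ f h1)) ->
  forall t, g ((odot_l N - odot_r N) t) = 0.
Proof.
move=> gE t; rewrite linBE linearB.
apply/eqP; rewrite subr_eq0; apply/eqP.
apply: (@tens_ind _ _ _ _ (fun t => g (odot_l N t)) (fun t => g (odot_r N t))); try lin.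
by move=> h f /=; rewrite !tliftE ?gE ?linear_sw //; lin.
Qed.

Lemma odot_ext (W : lmodType k) (F G : odot N -> W) : linear F -> linear G ->
  (forall h n, F [h, n] = G [h, n]) -> F =1 G.
Proof.
move=> FL GL E; apply: (@coker_ext _ _ _ _ _ (mklin _ FL) (mklin _ GL)).
apply: (@tens_ind _ _ _ _ (fun t => F (cokerpi _ t)) (fun t => G (cokerpi _ t))) => //.
- by apply: (@lin_comp _ _ _ _ F (fun t => cokerpi _ t)) => //; lin.
- by apply: (@lin_comp _ _ _ _ G (fun t => cokerpi _ t)) => //; lin.
Qed.

Definition prime_coact0 : {linear (H ⊗ N)%type -> (odot N ⊗ H)%type} :=
  \lin t => \sw_(h, n <- t) \sw_(h1, h2 <- Delta h) [h1, n] ⊗ h2.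
Lemma prime_coact_subproof t : prime_coact0 ((odot_l N - odot_r N) t) = 0.
Proof.
apply: odot_descend => {t} h f; rewrite /= tliftE; last by lin.
under [RHS]eq_sw => h1 h2 do [rewrite tliftE; last by lin].
rewrite -(@swA _ _ _ (fun h1 h2 h3 => [h2, f h1] ⊗ h3)); try lin.
by apply: eq_sw => h1 h2; rewrite odot_rel (lin_sw _ _ ((tens_bilin _ _).1 _)).
Qed.
Definition prime_coact : {linear odot N -> (odot N ⊗ H)%type} :=
  coker_lift prime_coact_subproof.
Lemma prime_coactE h n : prime_coact [h, n] = \sw_(h1, h2 <- Delta h) [h1, n] ⊗ h2.
Proof. by rewrite /prime_coact coker_liftE /= tliftE //; lin. Qed.

Definition prime_act0 (x : H) : {linear (H ⊗ N)%type -> odot N} :=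
  \lin t => \sw_(h, n <- t) \sw3_(x1, x2, x3 <- x) [x3 * h * S x1, cact N x2 n].
Lemma prime_act_subproof x t : prime_act0 x ((odot_l N - odot_r N) t) = 0.
Proof.
apply: odot_descend => {t} h f; rewrite /= tliftE; last by lin.
pose F y a b c d e := [e * y.2 * S a, cact N c (f (d * y.1 * b))].
transitivity (\sw_(h1, h2 <- Delta h) \sw3_(x1, x2, x3 <- x) F (h1, h2) x1 1 x2 1 x3); last first.
  apply: eq_sw => h1 h2; rewrite tliftE; last by lin.
  by do 2!apply: eq_sw => ? ?; rewrite /F /= mul1r mulr1.
under [RHS]eq_sw => h1 h2.
  rewrite -(@sw_collapse _ _ _ (F (h1, h2)) _ _ _ _ _ (fun a b => S a * b) (fun a b => S a * b));
   try (by rewrite /F; lin); try exact: antipodel.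
  over.
rewrite [RHS]sw_exch; apply: eq_sw => x1 t.
rewrite [RHS]sw_exch; apply: eq_sw => x2 x3.
rewrite ayd_ctrP odot_rel.
under eq_sw => c d.
  rewrite linear_mk (@lin_sw _ _ _ _ _ (fun m => [d, m])); last by lin.
  under eq_sw => b1 u do [rewrite (@lin_sw _ _ _ _ _ (fun m => [d, m])); last by lin].
  over.
rewrite sw_exch [RHS]sw_exch; apply: eq_sw => b1 u.
rewrite sw_exch [RHS]sw_exch; apply: eq_sw => b2 b3.
rewrite (@sw_DeltaM _ _ _ (fun c d => [d, cact N b2 (f (S b3 * c * b1))])); last by lin.
rewrite (@sw_DeltaM _ _ _ (fun e g => \sw_(c, d <- Delta (S x1))
  [g * d, cact N b2 (f (S b3 * (e * c) * b1))])); last by lin.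
under eq_sw => c1 c2.
  under eq_sw => h1 h2.
    rewrite (@sw_DeltaS _ _ _ (fun a b =>
      [c2 * h2 * b, cact N b2 (f (S b3 * (c1 * h1 * a) * b1))])); last by lin.
    over.
  over.
rewrite sw_exch; apply: eq_sw => h1 h2.
rewrite sw_exch; apply: eq_sw => a1 a2; apply: eq_sw => c1 c2.
by rewrite /F /= !mulrA.
Qed.
Definition prime_act : {linear H -> {linear odot N -> odot N}} :=
  mklin (fun x => coker_lift (prime_act_subproof x)) ltac:(rewrite /prime_act0; lin).
Lemma prime_actE x h n :
  prime_act x [h, n] = \sw3_(x1, x2, x3 <- x) [x3 * h * S x1, cact N x2 n].
Proof. by rewrite [prime_act x]linear_mk coker_liftE /= tliftE //; lin. Qed.

Lemma prime_act1 m : prime_act 1 m = m.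
Proof.
apply: (@odot_ext _ (fun m => prime_act 1 m) id); try lin; move=> h n.
rewrite prime_actE.
rewrite (@sw3_1 _ _ _ (fun x1 x2 x3 => [x3 * h * S x1, cact N x2 n])); try lin.
by rewrite antipode1 cact1 mul1r mulr1.
Qed.

Lemma prime_actM x y m : prime_act (x * y) m = prime_act x (prime_act y m).
Proof.
apply: (@odot_ext _ (fun m => prime_act (x * y) m)
  (fun m => prime_act x (prime_act y m))); try lin; move=> h n.
rewrite !prime_actE.
rewrite (@sw3_M _ _ _ (fun x1 x2 x3 => [x3 * h * S x1, cact N x2 n])); try lin.
transitivity (\sw3_(y1, y2, y3 <- y) prime_act x [y3 * h * S y1, cact N y2 n]); last first.
  by rewrite linear_sw; apply: eq_sw => y1 t; rewrite linear_sw.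
under [RHS]eq_sw => y1 t. under eq_sw => y2 y3 do rewrite prime_actE. over.
transitivity (\sw_(x1, t <- Delta x) \sw_(y1, u <- Delta y) \sw_(y2, y3 <- Delta u)
   \sw_(x2, x3 <- Delta t) [x3 * (y3 * h * S y1) * S x1, cact N x2 (cact N y2 n)]).
  apply: eq_sw => x1 t; rewrite sw_exch; apply: eq_sw => y1 u.
  rewrite sw_exch; apply: eq_sw => y2 y3; apply: eq_sw => x2 x3.
  by rewrite antipodeM cactM !mulrA.
rewrite sw_exch; apply: eq_sw => y1 u.
by rewrite sw_exch.
Qed.

Lemma sw_prime_coact (W : lmodType k) (F : odot N -> H -> W) h n : bilin F ->
  \sw_(a, b <- prime_coact [h, n]) F a b = \sw_(h1, h2 <- Delta h) F [h1, n] h2.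
Proof.
move=> FB; rewrite prime_coactE sw_sw //.
by apply: eq_sw => h1 h2; rewrite tliftE.
Qed.

Lemma prime_coactA m :
  \sw_(n, b <- prime_coact m) \sw_(p, a <- prime_coact n) p ⊗ (a ⊗ b) =
  \sw_(n, b <- prime_coact m) \sw_(c, d <- Delta b) n ⊗ (c ⊗ d).
Proof.
apply: (@odot_ext _
  (fun m => \sw_(n, b <- prime_coact m) \sw_(p, a <- prime_coact n) p ⊗ (a ⊗ b))
  (fun m => \sw_(n, b <- prime_coact m) \sw_(c, d <- Delta b) n ⊗ (c ⊗ d))); try lin.
move=> h n; rewrite !sw_prime_coact; try lin.
under eq_sw => h1 h2 do [rewrite sw_prime_coact; last by lin].
by rewrite (@swA _ _ _ (fun a b c => [a, n] ⊗ (b ⊗ c))); try lin.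
Qed.

Lemma prime_coact1 m : \sw_(n, b <- prime_coact m) counit b *: n = m.
Proof.
apply: (@odot_ext _ (fun m => \sw_(n, b <- prime_coact m) counit b *: n) id); try lin.
move=> h n; rewrite sw_prime_coact; last by lin.
by rewrite (@sw_counitr _ _ _ (fun h => [h, n])) //; lin.
Qed.

Lemma prime_ayd x m : prime_coact (prime_act x m) =
  \sw3_(x1, x2, x3 <- x) \sw_(m0, m1 <- prime_coact m)
    prime_act x2 m0 ⊗ (x3 * m1 * S x1).
Proof.
apply: (@odot_ext _ (fun m => prime_coact (prime_act x m)) (fun m =>
  \sw3_(x1, x2, x3 <- x) \sw_(m0, m1 <- prime_coact m)
    prime_act x2 m0 ⊗ (x3 * m1 * S x1))); try lin.
move=> h n.
pose F y a b c d e := [d * y.1 * S b, cact N c n] ⊗ (e * y.2 * S (a : H)).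
transitivity (\sw_(h1, h2 <- Delta h) \sw3_(x1, x2, x3 <- x)
   \sw3_(g1, g2, g3 <- x2) F (h1, h2) x1 g1 g2 g3 x3); last first.
  rewrite sw_exch; apply: eq_sw => x1 t; rewrite sw_exch; apply: eq_sw => x2 x3.
  rewrite sw_prime_coact; last by lin.
  apply: eq_sw => h1 h2; rewrite prime_actE.
  rewrite (lin_sw _ _ ((tens_bilin _ _).1 _)); apply: eq_sw => g1 u.
  by rewrite (lin_sw _ _ ((tens_bilin _ _).1 _)).
under [RHS]eq_sw => h1 h2.
  rewrite -(@sw_expand _ _ _ (F (h1, h2))); try (by rewrite /F; lin).
  over.
rewrite prime_actE linear_sw [RHS]sw_exch; apply: eq_sw => x1 t.
rewrite linear_sw [RHS]sw_exch; apply: eq_sw => x2 x3.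
rewrite prime_coactE.
rewrite (@sw_DeltaM _ _ _ (fun c d => [c, cact N x2 n] ⊗ d)); last by lin.
rewrite (@sw_DeltaM _ _ _ (fun e g => \sw_(c, d <- Delta (S x1))
  [e * c, cact N x2 n] ⊗ (g * d))); last by lin.
rewrite sw_exch; apply: eq_sw => h1 h2.
rewrite [RHS]sw_exch; apply: eq_sw => c1 c2.
rewrite (@sw_DeltaS _ _ _ (fun a b => [c1 * h1 * a, cact N x2 n] ⊗ (c2 * h2 * b))) //.
lin.
Qed.

Definition primeH : aydMod H :=
  AydMod prime_act1 prime_actM prime_coactA prime_coact1 prime_ayd.
End Prime.

Record category := Category {
  cobj :> Type;
  chom : cobj -> cobj -> Type;
  cid : forall x, chom x x;
  ccomp : forall x y z, chom y z -> chom x y -> chom x z;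
  ccompA : forall x y z t (f : chom z t) (g : chom y z) (h : chom x y),
    ccomp f (ccomp g h) = ccomp (ccomp f g) h;
  ccomp1l : forall x y (f : chom x y), ccomp (cid y) f = f;
  ccomp1r : forall x y (f : chom x y), ccomp f (cid x) = f
}.

Record functor (C D : category) := Functor {
  fobj :> C -> D;
  fmap : forall x y, chom x y -> chom (fobj x) (fobj y);
  fmap1 : forall x, fmap (cid x) = cid (fobj x);
  fmapM : forall x y z (f : chom y z) (g : chom x y),
    fmap (ccomp f g) = ccomp (fmap f) (fmap g)
}.

Definition full_subcat (C : category) (P : C -> Prop) : category :=
  @Category {x : C | P x} (fun x y => chom (sval x) (sval y))
    (fun x => cid (sval x)) (fun x y z => @ccomp C (sval x) (sval y) (sval z))
    (fun x y z t => @ccompA C (sval x) (sval y) (sval z) (sval t))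
    (fun x y => @ccomp1l C (sval x) (sval y)) (fun x y => @ccomp1r C (sval x) (sval y)).

Definition frestrict (C D : category) (P : C -> Prop) (Q : D -> Prop)
    (F : functor C D) (FP : forall x, P x -> Q (F x)) :
    functor (full_subcat P) (full_subcat Q) :=
  @Functor (full_subcat P) (full_subcat Q)
    (fun x => exist Q (F (sval x)) (FP (sval x) (svalP x)))
    (fun x y => @fmap C D F (sval x) (sval y)) (fun x => fmap1 F (sval x))
    (fun x y z => @fmapM C D F (sval x) (sval y) (sval z)).

Arguments frestrict {C D P Q} F FP.

(* F is left adjoint to G. *)
Definition adjoint (C D : category) (F : functor C D) (G : functor D C) : Prop :=
  exists phi : forall (x : C) (y : D), chom (F x) y -> chom x (G y),
    (forall x y, bijective (phi x y)) /\
    (forall (x x' : C) (y y' : D) (u : chom x' x) (v : chom y y') (f : chom (F x) y),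
       phi x' y' (ccomp v (ccomp f (fmap F u))) = ccomp (fmap G v) (ccomp (phi x y f) u)).

Section Categories.
#[local] Obligation Tactic := idtac.
Variables (k : fieldType) (H : hopfAlg k).

Record mod_hom (M M' : aydMod H) := ModHom {
  mfun :> {linear M -> M'};
  mfun_act : forall h m, mfun (mact M h m) = mact M' h (mfun m);
  mfun_coact : forall m, mcoact M' (mfun m) = \sw_(m0, m1 <- mcoact M m) mfun m0 ⊗ m1
}.

Record ctr_hom (N N' : aydCtr H) := CtrHom {
  cfun :> {linear N -> N'};
  cfun_act : forall h n, cfun (cact N h n) = cact N' h (cfun n);
  cfun_alpha : forall f, cfun (calpha N f) = calpha N' (\lin h => cfun (f h))
}.

Lemma mod_hom_ext M M' (f g : mod_hom M M') : (forall m, f m = g m) -> f = g.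
Proof.
case: f g => f f1 f2 [g g1 g2] /= /lin_ext fg; case: _ / fg in g1 g2 *.
by congr ModHom; apply: Prop_irrelevance.
Qed.
Lemma ctr_hom_ext N N' (f g : ctr_hom N N') : (forall n, f n = g n) -> f = g.
Proof.
case: f g => f f1 f2 [g g1 g2] /= /lin_ext fg; case: _ / fg in g1 g2 *.
by congr CtrHom; apply: Prop_irrelevance.
Qed.

Program Definition mod_id (M : aydMod H) : mod_hom M M := @ModHom M M (\lin m => m) _ _.
Next Obligation. by []. Qed.
Next Obligation. by move=> M m /=; rewrite tensE. Qed.
Program Definition mod_comp (M1 M2 M3 : aydMod H) (f : mod_hom M2 M3) (g : mod_hom M1 M2) :
  mod_hom M1 M3 := @ModHom M1 M3 (\lin m => f (g m)) _ _.
Next Obligation. by move=> M1 M2 M3 f g h m /=; rewrite !mfun_act. Qed.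
Next Obligation.
move=> M1 M2 M3 f g m /=; rewrite !mfun_coact sw_sw; last by lin.
by apply: eq_sw => a b; rewrite tliftE //; lin.
Qed.
Definition aydMod_cat : category.
Proof.
by refine (@Category (aydMod H) mod_hom mod_id mod_comp _ _ _); move=> *; apply: mod_hom_ext.
Defined.

Program Definition ctr_id (N : aydCtr H) : ctr_hom N N := @CtrHom N N (\lin n => n) _ _.
Next Obligation. by []. Qed.
Next Obligation. by move=> N f /=; congr (calpha N _); apply: lin_ext. Qed.
Program Definition ctr_comp (N1 N2 N3 : aydCtr H) (f : ctr_hom N2 N3) (g : ctr_hom N1 N2) :
  ctr_hom N1 N3 := @CtrHom N1 N3 (\lin n => f (g n)) _ _.
Next Obligation. by move=> N1 N2 N3 f g h n /=; rewrite !cfun_act. Qed.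
Next Obligation.
move=> N1 N2 N3 f g t /=; rewrite !cfun_alpha.
by congr (calpha N3 _); apply: lin_ext.
Qed.
Definition aydCtr_cat : category.
Proof.
by refine (@Category (aydCtr H) ctr_hom ctr_id ctr_comp _ _ _); move=> *; apply: ctr_hom_ext.
Defined.

Lemma hat_map_subproof (M M' : aydMod H) (f : mod_hom M M') (t : hatT M) :
  (\lin h => f (hatval t h)) \in @comod_map k H M'.
Proof.
apply/asboolP => h; rewrite !linear_mk mfun_coact hatE sw_sw; last by lin.
by apply: eq_sw => a b; rewrite tliftE //; lin.
Qed.
Program Definition hat_map (M M' : aydMod H) (f : mod_hom M M') :
    ctr_hom (hatH M) (hatH M') :=
  @CtrHom (hatH M) (hatH M') (\lin t => Hat (hat_map_subproof f t)) _ _.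
Next Obligation.
move=> M M' f h t; apply: hat_ext => x /=; rewrite linear_sw; apply: eq_sw => h1 u.
by rewrite linear_sw; apply: eq_sw => h2 h3; rewrite mfun_act.
Qed.
Next Obligation. by move=> M M' f t; apply: hat_ext => x /=; rewrite linear_sw. Qed.

Definition hat_functor : functor aydMod_cat aydCtr_cat.
Proof.
refine (@Functor aydMod_cat aydCtr_cat (@hatH k H) hat_map _ _).
- by move=> M; apply: ctr_hom_ext => t; apply: hat_ext.
- by move=> M1 M2 M3 f g; apply: ctr_hom_ext => t; apply: hat_ext.
Defined.

Definition prime_map0 (N N' : aydCtr H) (f : ctr_hom N N') : {linear (H ⊗ N)%type -> odot N'} :=
  \lin t => \sw_(h, n <- t) odot_cls h (f n).
Lemma prime_map_subproof (N N' : aydCtr H) (f : ctr_hom N N') t :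
  prime_map0 f ((odot_l N - odot_r N) t) = 0.
Proof.
apply: odot_descend => {t} h u; rewrite /= tliftE; last by lin.
rewrite cfun_alpha odot_rel; apply: eq_sw => h1 h2.
by rewrite tliftE //; lin.
Qed.
Definition prime_fun (N N' : aydCtr H) (f : ctr_hom N N') : {linear odot N -> odot N'} :=
  coker_lift (prime_map_subproof f).
Lemma prime_funE (N N' : aydCtr H) (f : ctr_hom N N') h n :
  prime_fun f (odot_cls h n) = odot_cls h (f n).
Proof. by rewrite /prime_fun coker_liftE /= tliftE //; lin. Qed.

Program Definition prime_map (N N' : aydCtr H) (f : ctr_hom N N') :
    mod_hom (primeH N) (primeH N') :=
  @ModHom (primeH N) (primeH N') (prime_fun f) _ _.
Next Obligation.
move=> N N' f x m.
apply: (@odot_ext _ _ _ _ (fun m => prime_fun f (prime_act N x m))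
  (fun m => prime_act N' x (prime_fun f m))) m; try lin.
move=> h n; rewrite prime_funE !prime_actE linear_sw; apply: eq_sw => x1 t.
by rewrite linear_sw; apply: eq_sw => x2 x3; rewrite prime_funE cfun_act.
Qed.
Next Obligation.
move=> N N' f m.
apply: (@odot_ext _ _ _ _ (fun m => prime_coact N' (prime_fun f m))
  (fun m => \sw_(m0, m1 <- prime_coact N m) prime_fun f m0 ⊗ m1)) m; try lin.
move=> h n; rewrite prime_funE prime_coactE sw_prime_coact; last by lin.
by apply: eq_sw => h1 h2; rewrite prime_funE.
Qed.

Definition prime_functor : functor aydCtr_cat aydMod_cat.
Proof.
refine (@Functor aydCtr_cat aydMod_cat (@primeH k H) prime_map _ _).
- move=> N; apply: mod_hom_ext => /=.
  apply: (@odot_ext _ _ _ _ (fun m => prime_fun (ctr_id N) m) id); try lin.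
  by move=> h n; rewrite prime_funE.
- move=> N1 N2 N3 f g; apply: mod_hom_ext => /=.
  apply: (@odot_ext _ _ _ _ (fun m => prime_fun (ctr_comp f g) m)
    (fun m => prime_fun f (prime_fun g m))); try lin.
  by move=> h n; rewrite !prime_funE.
Defined.

Definition saydMod_cat : category := full_subcat (C := aydMod_cat) (@mstable k H).
Definition saydCtr_cat : category := full_subcat (C := aydCtr_cat) (@cstable k H).
End Categories.

(* Main.v *)
Require Import Defs.
From mathcomp Require Import all_boot all_algebra.
From mathcomp Require Import boolp.

Set Implicit Arguments.
Unset Strict Implicit.
Unset Printing Implicit Defensive.
Import GRing.Theory.
Local Open Scope ring_scope.

(** The adjunction is currying.  A map [f] out of [H ⊙_H N] is a bilinear pairing
    [b(h, n) = f [h, n]]; the relation [[h, α(g)] = [h^2, g(h^1)]] defining [H ⊙_H N]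
    says that [n |-> b(-, n)] preserves contraactions, and [f] is colinear exactly when
    every [b(-, n)] is.  The two forms of [H]-linearity,
    [b(x^3 h S(x^1), x^2 n) = x b(h, n)] and [b(h, x n) = x^2 b(S(x^3) h x^1, n)],
    imply each other: rewriting the right-hand side of the second with the first leaves
    the factors [x^1 S(x^2)] and [x^4 S(x^5)], and rewriting the left-hand side of the
    first with the second leaves [S(x^1) x^2] and [S(x^4) x^5]; all of them collapse.

    The functors are thus adjoint even without stability.  They preserve stability because
    it says that [m |-> m_1 m_0], respectively [n |-> α(r_n)], is the identity, and both
    functors carry one of these endomorphisms to the other. *)

Lemma adjoint_frestrict (C D : category) (P : C -> Prop) (Q : D -> Prop)
    (F : functor C D) (G : functor D C)
    (FP : forall x, P x -> Q (F x)) (GQ : forall y, Q y -> P (G y)) :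
  adjoint F G -> adjoint (frestrict F FP) (frestrict G GQ).
Proof.
case=> phi [phi_bij phi_nat].
exists (fun x y => phi (sval x) (sval y)).
by split=> *; [apply: phi_bij|apply: phi_nat].
Qed.

Section Sweedler5.
Variables (k : fieldType) (H : hopfAlg k) (W : lmodType k) (G : H -> H -> H -> W).
Hypotheses (G1 : forall b c, linear (fun a => G a b c))
  (G2 : forall a c, linear (fun b => G a b c))
  (G3 : forall a b, linear (G a b)).
Local Notation S := antipode.

Lemma sw5_conv (p q : H -> H -> H) x : bilin p -> bilin q ->
  (forall h, \sw_(a, b <- Delta h) p a b = counit h *: 1) ->
  (forall h, \sw_(a, b <- Delta h) q a b = counit h *: 1) ->
  \sw3_(a, b, c <- x) \sw3_(b1, b2, b3 <- b) G (p a b1) b2 (q b3 c) = G 1 x 1.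
Proof.
move=> [p1 p2] [q1 q2] pE qE.
rewrite -(@sw_expand _ _ _ (fun a b c d e => G (p a b) c (q d e))); try lin.
have ends_collapse a b c :
    \sw_(a1, a2 <- Delta a) \sw_(c1, c2 <- Delta c) G (p a1 a2) b (q c1 c2) =
    counit a *: (counit c *: G 1 b 1).
  under eq_sw => a1 a2 do rewrite -(lin_sw _ _ (G3 _ _)) qE (lin_Z _ _ (G3 _ _)).
  rewrite sw_scale -(lin_sw _ _ (G1 b 1)) pE (lin_Z _ _ (G1 b 1)).
  by rewrite !scalerA mulrC.
under eq_sw => a t.
  under eq_sw => b c do rewrite ends_collapse.
  rewrite sw_scale (@sw_counitr _ _ _ (fun b => G 1 b 1)) //.
  over.
exact: (@sw_counitl _ _ _ (fun b => G 1 b 1)).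
Qed.

Lemma sw5_Sl x :
  \sw3_(a, b, c <- x) \sw3_(b1, b2, b3 <- b) G (S a * b1) b2 (S b3 * c) = G 1 x 1.
Proof.
apply: (@sw5_conv (fun a b => S a * b) (fun a b => S a * b)); try lin;
  exact: antipodel.
Qed.

Lemma sw5_Sr x :
  \sw3_(a, b, c <- x) \sw3_(b1, b2, b3 <- b) G (a * S b1) b2 (b3 * S c) = G 1 x 1.
Proof.
apply: (@sw5_conv (fun a b => a * S b) (fun a b => a * S b)); try lin;
  exact: antipoder.
Qed.
End Sweedler5.

Section Equivariance.
Variables (k : fieldType) (H : hopfAlg k) (M N : lmodType k).
Variables (actM : {linear H -> {linear M -> M}}) (actN : {linear H -> {linear N -> N}}).
Variable b : H -> N -> M.
Local Notation S := antipode.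

Definition prime_equivariant : Prop := forall x h n,
  \sw3_(x1, x2, x3 <- x) b (x3 * h * S x1) (actN x2 n) = actM x (b h n).

Definition hat_equivariant : Prop := forall x h n,
  b h (actN x n) = \sw3_(x1, x2, x3 <- x) actM x2 (b (S x3 * h * x1) n).

Lemma prime_hat_equivariant : bilin b -> prime_equivariant <-> hat_equivariant.
Proof.
move=> [b1 b2]; split=> bE x h n.
- pose G a y c := b (c * h * a) (actN y n).
  have <- : G 1 x 1 = b h (actN x n) by rewrite /G mul1r mulr1.
  rewrite -(@sw5_Sr _ _ _ G); try by rewrite /G; lin.
  apply: eq_sw => x1 t; apply: eq_sw => x2 x3; rewrite -bE.
  by do 2!apply: eq_sw => ? ?; rewrite /G !mulrA.
- pose G a y c := actM y (b (c * h * a) n).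
  have <- : G 1 x 1 = actM x (b h n) by rewrite /G mul1r mulr1.
  rewrite -(@sw5_Sl _ _ _ G); try by rewrite /G; lin.
  apply: eq_sw => x1 t; apply: eq_sw => x2 x3; rewrite bE.
  by do 2!apply: eq_sw => ? ?; rewrite /G !mulrA.
Qed.
End Equivariance.

Section OdotUniversal.
Variables (k : fieldType) (H : hopfAlg k) (N : aydCtr H) (W : lmodType k).
Local Notation "[ h , n ]" := (odot_cls (N := N) h n).

Lemma odot_lin_ext (F G : {linear odot N -> W}) :
  (forall h n, F [h, n] = G [h, n]) -> F =1 G.
Proof. by apply: odot_ext; apply: linearP. Qed.

Definition balanced (b : H -> N -> W) : Prop := forall h f,
  b h (calpha N f) = \sw_(h1, h2 <- Delta h) b h2 (f h1).

Variable b : H -> N -> W.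
Hypotheses (b_bilin : bilin b) (b_balanced : balanced b).

Let tensor_lift : {linear (H ⊗ N)%type -> W} := mklin _ (tlift_linear b_bilin).

Lemma odot_lift_subproof t : tensor_lift ((odot_l N - odot_r N) t) = 0.
Proof.
apply: odot_descend => {t} h f; rewrite /= tliftE // b_balanced.
by apply: eq_sw => h1 h2; rewrite tliftE.
Qed.

Definition odot_lift : {linear odot N -> W} := coker_lift odot_lift_subproof.

Lemma odot_liftE h n : odot_lift [h, n] = b h n.
Proof. by rewrite /odot_lift coker_liftE /= tliftE. Qed.
End OdotUniversal.

Section Stability.
Variables (k : fieldType) (H : hopfAlg k).
Implicit Types (M : aydMod H) (N : aydCtr H).

Definition mtwist M : {linear M -> M} :=
  \lin m => \sw_(m0, m1 <- mcoact M m) mact M m1 m0.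

Definition ctwist N : {linear N -> N} := \lin n => calpha N (\lin h => cact N h n).

(* [h^2 . [h^1, n] = [h^4 h^1 S(h^2), h^3 n] = [h^2, h^1 n] = [h, α(r_n)]] *)
Lemma mtwist_prime N h n :
  mtwist (primeH N) (odot_cls h n) = odot_cls h (ctwist N n).
Proof.
pose G (y t : H) := \sw_(b, c <- Delta t) odot_cls (c * y) (cact N b n).
have twistE : mtwist (primeH N) (odot_cls h n) =
    \sw3_(h1, h2, t <- h) G (h1 * antipode h2) t.
  rewrite linear_mk (@sw_prime_coact _ _ _ _ (fun m0 m1 => prime_act N m1 m0));
    last by lin.
  apply: eq_sw => h1 u; rewrite prime_actE; apply: eq_sw => h2 t.
  by apply: eq_sw => b c; rewrite mulrA.
rewrite twistE sw_Sr3; last by rewrite /G; lin.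
by rewrite odot_rel; apply: eq_sw => b c; rewrite mulr1.
Qed.

(* [(h^1 . φ)(h^2) = h^2 φ(S(h^3) h^4 h^1) = h^2 φ(h^1) = φ(h)_1 φ(h)_0] *)
Lemma ctwist_hat M (phi : hatH M) h :
  hatval (ctwist (hatH M) phi) h = mtwist M (hatval phi h).
Proof.
rewrite /= hatE sw_sw; last by lin.
rewrite (@swA _ _ _ (fun a s d => \sw_(b, c <- Delta s)
  mact M b (hatval phi (antipode c * d * a)))); try lin.
apply: eq_sw => a t; rewrite tliftE; last by lin.
rewrite (@swA _ _ _ (fun b c d => mact M b (hatval phi (antipode c * d * a))));
  try lin.
rewrite (@sw_3Sl _ _ _ (fun b y => mact M b (hatval phi (y * a)))); last by lin.
by rewrite mul1r.
Qed.

Lemma mstable_primeH N : cstable N -> mstable (primeH N).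
Proof.
move=> N_stable; apply: (@odot_lin_ext _ _ _ _ (mtwist (primeH N)) idfun) => h n.
by rewrite mtwist_prime [ctwist N n]N_stable.
Qed.

Lemma cstable_hatH M : mstable M -> cstable (hatH M).
Proof.
by move=> M_stable phi; apply: hat_ext => h; rewrite [LHS]ctwist_hat; apply: M_stable.
Qed.
End Stability.

Section Currying.
Variables (k : fieldType) (H : hopfAlg k) (N : aydCtr H) (M : aydMod H).
Local Notation "[ h , n ]" := (odot_cls (N := N) h n).

Section Curry.
Variable f : mod_hom (primeH N) M.

Lemma curry_comod_map n : (\lin h => f [h, n]) \in comod_map (M := M).
Proof.
by apply/asboolP => h; rewrite !linear_mk mfun_coact /= sw_prime_coact //; lin.
Qed.

Definition curry_lin : {linear N -> hatH M} := \lin n => Hat (curry_comod_map n).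

Lemma curry_act x n : curry_lin (cact N x n) = cact (hatH M) x (curry_lin n).
Proof.
have f_equivariant : prime_equivariant (mact M) (cact N) (fun h n => f [h, n]).
  move=> {x n} x h n; rewrite -mfun_act [mact _ _ _]prime_actE linear_sw.
  by apply: eq_sw => x1 t; rewrite linear_sw.
apply: hat_ext => h /=.
by apply: ((prime_hat_equivariant _ _ _).1 f_equivariant); lin.
Qed.

Lemma curry_alpha g :
  curry_lin (calpha N g) = calpha (hatH M) (\lin h => curry_lin (g h)).
Proof. by apply: hat_ext => h /=; rewrite odot_rel linear_sw. Qed.

Definition curry : ctr_hom N (hatH M) := CtrHom curry_act curry_alpha.
End Curry.

Section Uncurry.
Variable g : ctr_hom N (hatH M).
Let pairing h n := hatval (g n) h.

Lemma uncurry_bilin : bilin pairing.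
Proof. by rewrite /pairing; lin. Qed.

Lemma uncurry_balanced : balanced pairing.
Proof. by move=> h u; rewrite /pairing cfun_alpha. Qed.

Definition uncurry_lin : {linear odot N -> M} :=
  odot_lift uncurry_bilin uncurry_balanced.

Lemma uncurry_linE h n : uncurry_lin [h, n] = hatval (g n) h.
Proof. exact: odot_liftE. Qed.

Lemma uncurry_act x m :
  uncurry_lin (mact (primeH N) x m) = mact M x (uncurry_lin m).
Proof.
have g_equivariant : hat_equivariant (mact M) (cact N) pairing.
  by move=> {x m} x h n; rewrite /pairing cfun_act.
apply: (@odot_lin_ext _ _ _ _ (\lin m => uncurry_lin (prime_act N x m))
  (\lin m => mact M x (uncurry_lin m))) m => h n.
rewrite [LHS]linear_mk [RHS]linear_mk uncurry_linE.
rewrite -((prime_hat_equivariant _ _ uncurry_bilin).2 g_equivariant).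
rewrite prime_actE linear_sw; apply: eq_sw => x1 t.
by rewrite linear_sw; apply: eq_sw => x2 x3; rewrite uncurry_linE.
Qed.

Lemma uncurry_coact m :
  mcoact M (uncurry_lin m) =
  \sw_(m0, m1 <- mcoact (primeH N) m) uncurry_lin m0 ⊗ m1.
Proof.
apply: (@odot_lin_ext _ _ _ _ (\lin m => mcoact M (uncurry_lin m))
  (\lin m => \sw_(m0, m1 <- prime_coact N m) uncurry_lin m0 ⊗ m1)) m => h n.
rewrite [LHS]linear_mk [RHS]linear_mk uncurry_linE hatE.
rewrite sw_prime_coact; last by lin.
by apply: eq_sw => h1 h2; rewrite uncurry_linE.
Qed.

Definition uncurry : mod_hom (primeH N) M := ModHom uncurry_act uncurry_coact.
End Uncurry.

Lemma curryK : cancel curry uncurry.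
Proof.
move=> f; apply: mod_hom_ext; apply: odot_lin_ext => h n.
exact: uncurry_linE.
Qed.

Lemma uncurryK : cancel uncurry curry.
Proof.
by move=> g; apply: ctr_hom_ext => n; apply: hat_ext => h; apply: uncurry_linE.
Qed.
End Currying.

Lemma prime_hat_adjoint (k : fieldType) (H : hopfAlg k) :
  adjoint (prime_functor H) (hat_functor H).
Proof.
exists (@curry k H); split=> [N M|N N' M M' u v f].
  by exists (@uncurry k H N M); [apply: curryK|apply: uncurryK].
apply: ctr_hom_ext => n; apply: hat_ext => h.
by congr (v (f _)); apply: prime_funE.
Qed.

Theorem corollary3p9 (k : fieldType) (H : hopfAlg k)
  (char0 : [pchar k] =i pred0)
  (antipode_bij : bijective (@antipode k H)) :
  exists (prime_stable : forall N : aydCtr H, cstable N -> mstable (primeH N))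
         (hat_stable : forall M : aydMod H, mstable M -> cstable (hatH M)),
    adjoint
      (frestrict (prime_functor H) prime_stable : functor (saydCtr_cat H) (saydMod_cat H))
      (frestrict (hat_functor H) hat_stable : functor (saydMod_cat H) (saydCtr_cat H)).
Proof.
exists (@mstable_primeH k H), (@cstable_hatH k H).
exact: adjoint_frestrict (prime_hat_adjoint H).
Qed.
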